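(* (Principle of descent.) Let $(\mu_n)_{n\in\mathbb{N}}$ be a log-tight sequence of finite positive measures on $\mathbb{C}$, that is, $$\forall\epsilon>0,\ \exists\text{ a compact set }K\subset\mathbb{C},\ \forall n\in\mathbb{N},\quad \int_{\mathbb{C}\setminus K}\log(1+|t|)\,d\mu_n(t)\le\epsilon,$$ and assume that $\mu_n$ tends weak-* to a finite measure $\mu$. Then $$V^{\mu}(z)\le\liminf_{n\to\infty}V^{\mu_n}(z),\qquad z\in\mathbb{C}.$$ More generally, if $(z_n)$ is a sequence of points in $\mathbb{C}$ tending to a limit $z^*\in\mathbb{C}$, then $$V^{\mu}(z^* )\le\liminf_{n\to\infty}V^{\mu_n}(z_n).$$
   Context: The logarithmic potential of a measure $\sigma$ is $V^{\sigma}(z)=-\int\log|z-t|\,d\sigma(t)$. Measures are Borel measures on $\mathbb{C}$, whose supports may be unbounded. Weak-* convergence means $\int f\,d\mu_n\to\int f\,d\mu$ for every continuous compactly supported $f$ (for log-tight sequences this is equivalent to convergence against all bounded continuous functions). *)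

(* Defs.v *)
From HB Require Import structures.
From mathcomp Require Import all_boot all_order all_algebra.
From mathcomp Require Import all_classical all_reals all_analysis.
From mathcomp Require Export complex.

Set Implicit Arguments.
Unset Strict Implicit.
Unset Printing Implicit Defensive.

Import Order.TTheory GRing.Theory Num.Theory.
Import numFieldNormedType.Exports.

Local Open Scope classical_set_scope.
Local Open Scope ring_scope.

(* [Rcomplex R] is the field [R[i]] of complex numbers seen over [R]; its norm
   [`|z| : R] is the modulus [Normc.normc z]. The library gives it no topology
   and no sigma-algebra: we add the topology of the modulus and the Borel
   sigma-algebra. *)
HB.instance Definition _ (R : realType) :=
  PseudoMetric.copy (Rcomplex R) (pseudoMetric_normed (Rcomplex R)).
HB.instance Definition _ (R : realType) := isPointed.Build (Rcomplex R) 0.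
HB.instance Definition _ (R : realType) :=
  NormedZmod_PseudoMetric_eq.Build R (Rcomplex R) erefl.

Lemma Rcomplex_normrZ (R : realType) (l : R) (z : Rcomplex R) :
  `|l *: z| = `|l| * `|z|.
Proof.
case: z => a b; rewrite /Num.norm/= !exprMn -mulrDr sqrtrM ?sqr_ge0//.
by rewrite sqrtr_sqr.
Qed.

HB.instance Definition _ (R : realType) :=
  PseudoMetricNormedZmod_Lmodule_isNormedModule.Build R (Rcomplex R)
    (@Rcomplex_normrZ R).

HB.instance Definition _ (R : realType) :=
  @isMeasurable.Build (sigma_display (@open (Rcomplex R))) (Rcomplex R)
    <<s @open (Rcomplex R) >>
    (@sigma_algebra0 _ setT _) (@sigma_algebraC (Rcomplex R) _)
    (@sigma_algebra_bigcup _ setT _).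

Section potential.
Variable R : realType.
Implicit Types (sigma : {finite_measure set (Rcomplex R) -> \bar R})
  (mus : nat -> {finite_measure set (Rcomplex R) -> \bar R}).
Local Open Scope ereal_scope.

(* The logarithm is [lne], for which [lne 0 = -oo]: the real-valued [ln] is
   [0] at [0] and would ignore an atom of [sigma] at [z]. *)
Definition logpotential sigma (z : Rcomplex R) : \bar R :=
  - \int[sigma]_t lne (`|z - t|%R)%:E.

Definition log_tight mus : Prop :=
  forall e : R, (0 < e)%R ->
  exists2 K : set (Rcomplex R), compact K &
    forall n, \int[mus n]_(t in ~` K) (ln (1 + `|t|))%:E <= e%:E.

Definition weak_star_cvg mus sigma : Prop :=
  forall f : Rcomplex R -> R, continuous f ->
  compact (closure [set z | f z != 0%R]) ->
  \int[mus n]_z (f z)%:E @[n --> \oo] --> \int[sigma]_z (f z)%:E.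

End potential.

(* Main.v *)
Require Import Defs.
From mathcomp Require Import all_boot all_order all_algebra.
From mathcomp Require Import all_classical all_reals all_analysis.
From mathcomp Require Import measurable_realfun lra.

Set Implicit Arguments.
Unset Strict Implicit.
Unset Printing Implicit Defensive.

Import Order.TTheory GRing.Theory Num.Theory.
Import numFieldNormedType.Exports.

Local Open Scope classical_set_scope.
Local Open Scope ring_scope.

(** Write [w] for the limit of the points [z_n]. The kernel [log |w - t|] is
unbounded at both ends: it tends to [-oo] at [t = w] and to [+oo] at infinity.
The two singularities are treated separately.

At infinity, log-tightness lets weak-* convergence be tested on every continuous
function of at most logarithmic growth, not only on compactly supported ones
([weak_star_log_growth]): multiplying such a function by a cutoff changes its
integral against [mus n] by an amount that is small uniformly in [n]. The same
uniformity bounds the truncated integrals against [mu], hence such functions are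
[mu]-integrable ([weak_star_integrable]). This integrability also rules out
the form [+oo - +oo] in the integral of the kernel against [mu].

At the point [w], the kernel is regularised from above by the continuous
function [log (r + |w - t|)], [0 < r]. The triangle inequality makes it a
majorant of [log |z_n - t|] as soon as [|z_n - w| <= r] ([lne_le_reg_log]), which
absorbs the moving pole. So the upper limit of the integrals of [log |z_n - t|] against
[mus n] is at most the integral of [log (r + |w - t|)] against [mu], for each
[r], and monotone convergence as [r] decreases to [0] replaces this bound by the
integral of [log |w - t|] ([integral_lbound_decreasing]). A change of sign gives
the lower bound on the potentials. *)

(** * Topology and Borel sets of the complex plane *)

Section complex_plane.
Variable R : realType.

Lemma open_measurable_Rcomplex (U : set (Rcomplex R)) : open U -> measurable U.
Proof. exact: sub_sigma_algebra. Qed.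

Lemma continuous_measurable_Rcomplex (f : Rcomplex R -> R) :
  continuous f -> measurable_fun setT f.
Proof.
move=> cf; apply: (measurability _ (RGenOInfty.measurableE R)).
move=> /= _ [_ [a ->]] <-; rewrite setTI; apply: open_measurable_Rcomplex.
have /continuousP := cf; apply; exact: interval_open.
Qed.

Lemma closed_disc (M : R) : closed [set z : Rcomplex R | `|z| <= M].
Proof.
have /continuous_closedP := @norm_continuous R (Rcomplex R).
by move=> /(_ [set x | x <= M]); apply; exact: closed_le.
Qed.

(** The plane is the image of a product of two real lines under a continuous
map, so a closed disc is a closed part of the image of a compact square. *)
Lemma compact_disc (M : R) : compact [set z : Rcomplex R | `|z| <= M].
Proof.
pose f (p : R * R) : Rcomplex R :=
  p.1 *: (Complex 1 0 : Rcomplex R) + p.2 *: (Complex 0 1 : Rcomplex R).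
have cf : continuous f.
  move=> p; apply: (@continuousD _ (Rcomplex R)).
    by apply: (@continuousZr_tmp _ (Rcomplex R)); exact: cvg_fst.
  by apply: (@continuousZr_tmp _ (Rcomplex R)); exact: cvg_snd.
apply: (@subclosed_compact _ _ (f @` (`[- M, M] `*` `[- M, M]))).
- exact: closed_disc.
- apply: continuous_compact; first exact: continuous_subspaceT.
  by apply: compact_setX; exact: segment_compact.
- move=> [a b]; rewrite /= /Num.norm/= => abM; exists (a, b) => /=.
    have aM : `|a| <= M.
      by rewrite (le_trans _ abM)// -sqrtr_sqr ler_wsqrtr// lerDl sqr_ge0.
    have bM : `|b| <= M.
      by rewrite (le_trans _ abM)// -sqrtr_sqr ler_wsqrtr// lerDr sqr_ge0.
    by rewrite !in_itv/= -!ler_norml.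
  by apply/eqP; rewrite eq_complex /= !mulr0 !mulr1 add0r addr0 !eqxx.
Qed.

Lemma compact_sub_disc (K : set (Rcomplex R)) : compact K ->
  exists M : R, K `<=` [set z | `|z| <= M].
Proof.
move=> /compact_bounded[M [_ KM]]; exists (M + 1) => z Kz /=.
by apply: (KM (M + 1)); rewrite ?ltrDl.
Qed.

Lemma compact_measurable_Rcomplex (K : set (Rcomplex R)) :
  compact K -> measurable K.
Proof.
move=> cK; rewrite -[K]setCK; apply: measurableC; apply: open_measurable_Rcomplex.
by apply: closed_openC; apply: compact_closed => //; exact: norm_hausdorff.
Qed.

End complex_plane.

(** * Truncation by continuous cutoffs *)

Section cutoff.
Variable R : realType.
Implicit Types (k : R) (t : Rcomplex R).

Definition cutoff k t : R := Num.max 0 (Num.min 1 (k + 1 - `|t|)).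

Lemma cutoff_ge0 k t : 0 <= cutoff k t.
Proof. by rewrite /cutoff le_max lexx. Qed.

Lemma cutoff_le1 k t : cutoff k t <= 1.
Proof. by rewrite /cutoff ge_max ler01 ge_min lexx. Qed.

Lemma cutoff1 k t : `|t| <= k -> cutoff k t = 1.
Proof.
move=> tk; rewrite /cutoff min_l ?max_r//.
by rewrite -addrA addrCA lerDl subr_ge0.
Qed.

Lemma cutoff0 k t : k + 1 <= `|t| -> cutoff k t = 0.
Proof. by move=> tk; rewrite /cutoff max_l// ge_min subr_le0 tk orbT. Qed.

Lemma cutoff_mono t : {homo cutoff^~ t : k l / k <= l}.
Proof.
move=> k l kl; rewrite /cutoff ge_max !le_max lexx/=; apply/orP; right.
by rewrite le_min !ge_min lexx/= lerD2r lerD2r kl orbT.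
Qed.

Lemma continuous_cutoff k : continuous (cutoff k).
Proof.
move=> t; apply: (@continuous_max R (Rcomplex R) (cst 0)
  (fun u => Num.min 1 (k + 1 - `|u|))); first exact: cst_continuous.
have cdist : {for t, continuous (fun u : Rcomplex R => k + 1 - `|u|)}.
  apply: (@continuousB R R); first exact: cst_continuous.
  exact: norm_continuous.
apply: (@continuous_min R (Rcomplex R) (cst 1) (fun u => k + 1 - `|u|)) => //.
exact: cst_continuous.
Qed.

End cutoff.

Section truncation.
Variable R : realType.
Implicit Types nu : {finite_measure set (Rcomplex R) -> \bar R}.
Variable h : Rcomplex R -> R.
Hypothesis ch : continuous h.

Lemma continuous_trunc k : continuous (cutoff k \* h).
Proof.
move=> t; apply: (@continuousM R (Rcomplex R)); last exact: ch.
exact: continuous_cutoff.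
Qed.

Lemma compact_supp_trunc k :
  compact (closure [set t | (cutoff k \* h) t != 0]).
Proof.
apply: (subclosed_compact (@closed_closure _ _) (@compact_disc R (k + 1))).
rewrite [X in _ `<=` X](closure_id _).1; last exact: closed_disc.
apply: closureS => t /=; apply: contraNT; rewrite -ltNge => /ltW kt.
by rewrite cutoff0// mul0r.
Qed.

Lemma integrable_trunc nu k :
  nu.-integrable setT (EFin \o (cutoff k \* h)).
Proof.
apply: measurable_bounded_integrable => //.
- by rewrite ltey_eq fin_num_measure.
- by apply: continuous_measurable_Rcomplex; exact: continuous_trunc.
- have [M [_ hM]] : bounded_set (h @` [set z : Rcomplex R | `|z| <= k + 1]).
    apply: compact_bounded; apply: continuous_compact; last exact: compact_disc.
    exact: continuous_subspaceT.
  exists (`|M| + 1); split => // B MB t _ /=; apply: le_trans (ltW MB).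
  have [tk|/ltW kt] := leP `|t| (k + 1); last first.
    by rewrite cutoff0// mul0r normr0 addr_ge0.
  rewrite normrM ger0_norm ?cutoff_ge0//.
  apply: (le_trans (ler_wpM2r (normr_ge0 _) (cutoff_le1 _ _))); rewrite mul1r.
  by apply: (hM (`|M| + 1)); [rewrite (le_lt_trans (ler_norm _))// ltrDl|exists t].
Qed.

(** The truncation of [h] is bounded, and the measure is finite: only the tail
can prevent [h] from being integrable. *)
Lemma integrable_of_tail nu k :
  (\int[nu]_t (`|h t| * (1 - cutoff k t))%:E < +oo)%E ->
  nu.-integrable setT (EFin \o h).
Proof.
move=> tail.
have -> : EFin \o h = ((EFin \o (cutoff k \* h)%R) \+
    (EFin \o (h \* (fun t => 1 - cutoff k t))%R))%E.
  apply/funext => t /=; rewrite -EFinD; congr EFin.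
  by rewrite mulrBr mulr1 [h t * _]mulrC addrC subrK.
apply: integrableD => //; first exact: integrable_trunc.
apply/integrableP; split.
  apply/measurable_EFinP; apply: continuous_measurable_Rcomplex => t.
  apply: (@continuousM R (Rcomplex R)); first exact: ch.
  apply: (@continuousB R R); first exact: cst_continuous.
  exact: continuous_cutoff.
apply: le_lt_trans tail; rewrite le_eqVlt; apply/orP; left; apply/eqP.
apply: eq_integral => t _ /=; rewrite normrM [`|1 - _|]ger0_norm//.
by rewrite subr_ge0 cutoff_le1.
Qed.

Lemma near_trunc_eq (t : Rcomplex R) :
  \forall k \near \oo, (cutoff k%:R \* h) t = h t.
Proof.
near=> k; rewrite /= cutoff1 ?mul1r//.
by near: k; exact: nbhs_infty_ger.
Unshelve. all: by end_near. Qed.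

Lemma Rintegral_trunc_cvg nu : nu.-integrable setT (EFin \o h) ->
  \int[nu]_t (cutoff k%:R t * h t) @[k --> \oo] --> \int[nu]_t h t.
Proof.
move=> ih; apply: fine_cvg.
rewrite fineK ?integrable_fin_num//.
have := @dominated_convergence _ _ R nu setT measurableT
  (fun k => EFin \o (cutoff k%:R \* h)) (EFin \o h) (abse \o (EFin \o h)).
case=> //.
- move=> k; exact: (measurable_int _ (integrable_trunc nu _)).
- exact: measurable_int ih.
- apply: aeW => t _; apply: cvg_near_cst; near=> k.
  by congr EFin; near: k; exact: near_trunc_eq.
- exact: integrable_abse.
- apply: aeW => t k _ /=; rewrite lee_fin normrM ger0_norm ?cutoff_ge0//.
  by rewrite ler_piMl ?cutoff_le1.
Unshelve. all: by end_near. Qed.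

End truncation.

(** * Weak-* convergence against functions of logarithmic growth *)

Section log_growth.
Variables (R : realType)
  (mus : nat -> {finite_measure set (Rcomplex R) -> \bar R})
  (mu : {finite_measure set (Rcomplex R) -> \bar R}).
Hypotheses (mu_tight : log_tight mus) (mu_cvg : weak_star_cvg mus mu).

Definition log_growth (h : Rcomplex R -> R) := exists2 c : R, 0 < c &
  exists M : R, forall t, M <= `|t| -> `|h t| <= c * ln (1 + `|t|).

Lemma log_growth_norm h : log_growth h -> log_growth (Num.norm \o h).
Proof.
move=> [c c0 [M hM]]; exists c => //; exists M => t /hM /=.
by rewrite normr_id.
Qed.

Lemma continuous_ln1norm : continuous (fun t : Rcomplex R => ln (1 + `|t|)).
Proof.
move=> t; apply: (@continuous_comp _ _ _ (fun t : Rcomplex R => 1 + `|t|) (@ln R)).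
  apply: (@continuousD R R); first exact: cst_continuous.
  exact: norm_continuous.
by apply: continuous_ln; rewrite ltr_pwDl.
Qed.

(** Beyond a large enough radius, [t] lies outside the compact set provided by
log-tightness and [h] is dominated there by a multiple of [log (1 + |t|)], while
[1 - cutoff k] vanishes inside: the bound is uniform in [n]. *)
Lemma log_tight_tail h : continuous h -> log_growth h ->
  forall e : R, 0 < e -> exists k0 : R, forall k, k0 <= k -> forall n,
    (\int[mus n]_t (`|h t| * (1 - cutoff k t))%:E <= e%:E)%E.
Proof.
move=> ch [c c0 [M hM]] e e0.
have [K cK tK] := mu_tight (divr_gt0 e0 c0).
have [r Kr] := compact_sub_disc cK.
have mK : measurable (~` K).
  by apply: measurableC; exact: compact_measurable_Rcomplex.
have mln : measurable_fun setT (fun t : Rcomplex R => ln (1 + `|t|)).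
  by apply: continuous_measurable_Rcomplex; exact: continuous_ln1norm.
exists (Num.max r M) => k; rewrite ge_max => /andP[rk Mk] n.
apply: (@le_trans _ _ (\int[mus n]_(t in ~` K) (c * ln (1 + `|t|))%:E)%E).
  rewrite [leRHS]integral_mkcond; apply: ge0_le_integral => //.
  - by move=> t _; rewrite lee_fin mulr_ge0// subr_ge0 cutoff_le1.
  - apply/measurable_EFinP; apply: measurable_funM.
      apply: measurableT_comp; first exact: normr_measurable.
      exact: continuous_measurable_Rcomplex.
    apply: measurable_funB; first exact: measurable_cst.
    by apply: continuous_measurable_Rcomplex; exact: continuous_cutoff.
  - apply/(measurable_restrictT _ _).1 => //.
    apply/measurable_EFinP; apply: (@measurable_funS _ _ _ _ setT) => //.
    by apply: measurable_funM => //; exact: measurable_cst.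
  move=> t _; have [tk|kt] := leP `|t| k.
    rewrite cutoff1// subrr mulr0; apply: erestrict_ge0 => u _.
    by rewrite lee_fin mulr_ge0 ?(ltW c0)// ln_ge0// lerDl.
  rewrite patchE mem_set; last by move=> /Kr/=; rewrite leNgt (le_lt_trans rk).
  rewrite lee_fin; apply: le_trans (hM _ (le_trans Mk (ltW kt))).
  by rewrite ler_piMr// lerBlDr lerDl cutoff_ge0.
under eq_integral do rewrite EFinM.
rewrite ge0_integralZl_EFin//; last 3 first.
- by move=> t _; rewrite lee_fin ln_ge0// lerDl.
- by apply/measurable_EFinP; apply: (@measurable_funS _ _ _ _ setT).
- exact: ltW.
rewrite -[leRHS]/(e%:E) -[in leRHS](divfK (lt0r_neq0 c0) e) mulrC EFinM.
by apply: lee_wpmul2l; [rewrite lee_fin ltW|exact: tK].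
Qed.

Lemma log_tight_integrable h : continuous h -> log_growth h ->
  forall n, (mus n).-integrable setT (EFin \o h).
Proof.
move=> ch gh n; have [k0 hk0] := log_tight_tail ch gh ltr01.
apply: (@integrable_of_tail _ _ ch _ k0).
by apply: le_lt_trans (hk0 _ _ n) _ => //; exact: ltry.
Qed.

Lemma log_tight_trunc_dist h : continuous h -> log_growth h ->
  forall e : R, 0 < e -> exists k0 : R, forall k, k0 <= k -> forall n,
    `|\int[mus n]_t h t - \int[mus n]_t (cutoff k t * h t)| <= e.
Proof.
move=> ch gh e e0; have [k0 hk0] := log_tight_tail ch gh e0.
exists k0 => k kk n.
have ih := log_tight_integrable ch gh n.
have ihk : (mus n).-integrable setT (EFin \o (cutoff k \* h)) by
  exact: integrable_trunc.
have idiff : (mus n).-integrable setT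
    (EFin \o (fun t => h t - cutoff k t * h t)).
  exact: (integrableB measurableT ih ihk).
rewrite -RintegralB//; apply: le_trans (le_normr_Rintegral _ idiff) _ => //.
rewrite -lee_fin /Rintegral; apply: le_trans (hk0 k kk n).
rewrite fineK; last first.
  apply: integrable_fin_num => //.
  exact: (integrable_norm idiff).
rewrite le_eqVlt; apply/orP; left; apply/eqP.
apply: eq_integral => t _ ; congr EFin.
rewrite -[X in `|X - _|]mul1r -mulrBl normrM mulrC [`|1 - _|]ger0_norm//.
by rewrite subr_ge0 cutoff_le1.
Qed.

Lemma weak_star_trunc h k : continuous h ->
  \int[mus n]_t (cutoff k t * h t) @[n --> \oo] -->
  \int[mu]_t (cutoff k t * h t).
Proof.
move=> ch; apply: fine_cvg; rewrite fineK.
  apply: mu_cvg; first exact: continuous_trunc.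
  exact: compact_supp_trunc.
by apply: integrable_fin_num => //; exact: integrable_trunc.
Qed.

(** The truncations of [|h|] have [mu]-integrals that are limits of
[mus n]-integrals. The latter exceed those for one fixed cutoff by at most [1],
and those for the fixed cutoff converge; so the [mu]-integrals of all truncations
share one bound, which passes to [|h|] by monotone convergence. *)
Lemma weak_star_integrable h : continuous h -> log_growth h ->
  mu.-integrable setT (EFin \o h).
Proof.
move=> ch gh; pose g := Num.norm \o h.
have cg : continuous g.
  by move=> t; apply: continuous_comp; [exact: ch|exact: norm_continuous].
have gg : log_growth g by exact: log_growth_norm.
have [k0 hk0] := log_tight_trunc_dist cg gg ltr01.
apply/integrableP; split.
  by apply/measurable_EFinP; exact: continuous_measurable_Rcomplex.
pose C := \int[mu]_t (cutoff k0 t * g t) + 1.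
have truncC k : \int[mu]_t (cutoff k t * g t) <= C.
  have cC : \int[mus n]_t (cutoff k0 t * g t) + 1 @[n --> \oo] --> C.
    by apply: cvgD; [exact: weak_star_trunc|exact: cvg_cst].
  apply: (ler_cvg_to (weak_star_trunc (k := k) cg) cC).
  apply: nearW => n; rewrite -lerBlDl.
  apply: le_trans (hk0 k0 (lexx _) n); apply: le_trans (ler_norm _).
  rewrite lerD2r; apply: le_Rintegral => //.
  - exact: integrable_trunc.
  - exact: log_tight_integrable.
  - by move=> t _; rewrite ler_piMl ?cutoff_le1 ?normr_ge0.
have gk k t : (0 <= (cutoff k t * g t)%:E)%E.
  by rewrite lee_fin mulr_ge0 ?cutoff_ge0 ?normr_ge0.
suff : (\int[mu]_t `|(EFin \o h) t| <= C%:E)%E.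
  by move=> /le_lt_trans; apply; exact: ltry.
have := @cvg_monotone_convergence _ _ R mu setT measurableT
  (fun k t => (cutoff k%:R t * g t)%:E).
have -> : (fun t => limn ((fun k t => (cutoff k%:R t * g t)%:E)^~ t)) =
          (fun t => `|(EFin \o h) t|%E).
  apply/funext => t; apply/cvg_lim => //; apply: cvg_near_cst; near=> k.
  by congr EFin; near: k; exact: (near_trunc_eq g).
move=> /(_ _ _ _)/cvge_to_le; apply => //.
- move=> k; exact: (measurable_int _ (integrable_trunc cg mu _)).
- move=> t _ i j ij; rewrite lee_fin ler_wpM2r ?normr_ge0//.
  by apply: cutoff_mono; rewrite ler_nat.
apply: nearW => k; have := truncC k%:R; rewrite -lee_fin /Rintegral fineK//.
by apply: integrable_fin_num => //; exact: (integrable_trunc cg).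
Unshelve. all: by end_near. Qed.

(** One cutoff radius serves three thirds of the error: it makes the truncation
error small for all [mus n] at once and for [mu], and the truncated function is
compactly supported, hence a test function for weak-* convergence. *)
Lemma weak_star_log_growth h : continuous h -> log_growth h ->
  \int[mus n]_t h t @[n --> \oo] --> \int[mu]_t h t.
Proof.
move=> ch gh; apply/cvgrPdist_le => e e0.
have e3 : 0 < e / 3 by rewrite divr_gt0.
have [k0 hk0] := log_tight_trunc_dist ch gh e3.
have ih := weak_star_integrable ch gh.
have [k [kk0 kmu]] : exists k : nat, k0 <= k%:R /\
    `|\int[mu]_t h t - \int[mu]_t (cutoff k%:R t * h t)| <= e / 3.
  have /cvgrPdist_le/(_ _ e3) := Rintegral_trunc_cvg ch ih.
  move=> mue; have [k [? ?]] := filter_ex (filterI (nbhs_infty_ger k0) mue).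
  by exists k.
have /cvgrPdist_le/(_ _ e3) := weak_star_trunc (k := k%:R) ch.
apply: filterS => n; have := hk0 _ kk0 n; move: kmu.
rewrite !ler_norml => /andP[? ?] /andP[? ?] /andP[? ?].
by apply/andP; split; lra.
Qed.

End log_growth.

Local Open Scope ereal_scope.

(** * Integrals of extended real functions and lower limits *)

Section integral_facts.
Context d (T : measurableType d) (R : realType) (mu : {measure set T -> \bar R}).

(** The positive and the negative parts are compared separately, and the
convention [+oo - +oo = -oo] keeps subtraction monotone. This form covers the
kernel [log |z - t|], whose integral can be [-oo]. *)
Lemma le_integral_measurable (f g : T -> \bar R) :
  measurable_fun setT f -> measurable_fun setT g ->
  (forall x, f x <= g x) -> \int[mu]_x f x <= \int[mu]_x g x.
Proof.
move=> mf mg fg; rewrite [leLHS]integralE [leRHS]integralE; apply: leeB.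
- apply: ge0_le_integral => //; [exact: measurable_funepos| |].
    exact: measurable_funepos.
  by move=> x _; rewrite !funeposE ge_max !le_max lexx fg !orbT.
- apply: ge0_le_integral => //; [exact: measurable_funeneg| |].
    exact: measurable_funeneg.
  by move=> x _; rewrite !funenegE ge_max !le_max lexx leeN2 fg !orbT.
Qed.

(** Monotone convergence for a decreasing sequence, whose limit may take the
value [-oo]: the increasing nonnegative functions [f_ 0 - f_ k] have integrals
bounded by that of [f_ 0] minus [a], so their limit [g] is integrable, and
[f = f_ 0 - g] inherits integrability with the bound. *)
Lemma integral_lbound_decreasing (f_ : nat -> T -> R) (f : T -> \bar R) (a : R) :
  (forall k, mu.-integrable setT (EFin \o f_ k)) ->
  (forall x, {homo f_^~ x : k l / (k <= l)%N >-> (l <= k)%R}) ->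
  (forall x, (f_ k x)%:E @[k --> \oo] --> f x) ->
  (forall k, a%:E <= \int[mu]_x (f_ k x)%:E) -> a%:E <= \int[mu]_x f x.
Proof.
move=> if_ ndf f_f af_.
pose g x := (f_ 0 x)%:E - f x.
have mf_ k := measurable_int _ (if_ k).
have mf : measurable_fun setT f.
  by apply: (emeasurable_fun_cvg _ _ mf_) => x _; exact: f_f.
have f0 := integrable_fin_num measurableT (if_ 0%N).
have g_g x : ((f_ 0 x)%:E - (f_ k x)%:E) @[k --> \oo] --> g x.
  by apply: cvgeD; [rewrite fin_num_adde_defr|exact: cvg_cst|exact: cvgeN].
have g0 x : 0 <= g x.
  apply: (cvge_to_ge (g_g x)); apply: nearW => k.
  by rewrite -EFinB lee_fin subr_ge0 ndf.
have mg : measurable_fun setT g by exact: (emeasurable_funB (mf_ 0%N) mf).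
have gle : \int[mu]_x g x <= \int[mu]_x (f_ 0 x)%:E - a%:E.
  have := @cvg_monotone_convergence _ _ R mu setT measurableT
    (fun k x => (f_ 0 x)%:E - (f_ k x)%:E).
  have -> : (fun x => limn ((fun k x => (f_ 0 x)%:E - (f_ k x)%:E)^~ x)) = g.
    by apply/funext => x; apply/cvg_lim.
  move=> /(_ _ _ _)/cvge_to_le; apply => //.
  - by move=> k; exact: (emeasurable_funB (mf_ 0%N) (mf_ k)).
  - by move=> k x _; rewrite -EFinB lee_fin subr_ge0 ndf.
  - by move=> x _ k l kl; rewrite -!EFinB lee_fin lerB// ndf.
  - apply: nearW => k; rewrite (integralB measurableT (if_ 0%N) (if_ k)).
    by apply: leeB => //; exact: af_.
have ig : mu.-integrable setT g.
  apply/integrableP; split => //.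
  under eq_integral do rewrite gee0_abs//.
  by apply: le_lt_trans gle _; rewrite ltey_eq fin_numB f0.
have -> : f = (EFin \o f_ 0%N) \- g.
  apply/funext => x; rewrite /g /=; case: (f x) => [r| |]//=.
  by rewrite -!EFinB opprB addrC subrK.
rewrite integralB//= leeBrDr ?integrable_fin_num//.
by rewrite addeC -leeBrDr.
Qed.

End integral_facts.

Lemma limn_einf_ge (R : realType) (u : (\bar R)^nat) (a : \bar R) :
  (\forall n \near \oo, a <= u n) -> a <= limn_einf u.
Proof.
move=> [N _ Nu]; rewrite limn_einf_lim.
apply: lime_ge; first exact: is_cvg_einfs.
exists N => // k /= Nk; apply: le_ereal_inf_tmp => _ [n /= kn <-].
by apply: Nu => /=; exact: leq_trans kn.
Qed.

(** * The logarithmic kernel and its regularisations *)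

Section log_kernel.
Variable R : realType.
Implicit Types (v w t : Rcomplex R) (r : R).

Definition reg_log r w t : R := ln (r + `|w - t|)%R.

Lemma continuous_reg_log r w : (0 < r)%R -> continuous (reg_log r w).
Proof.
move=> r0 t.
apply: (@continuous_comp _ _ _ (fun t => r + `|w - t|)%R (@ln R)).
  apply: (@continuousD R R); first exact: cst_continuous.
  apply: (@continuous_comp _ _ _ (fun t => w - t)%R (@Num.norm _ (Rcomplex R))).
    apply: (@continuousB R (Rcomplex R)); first exact: cst_continuous.
    by move=> ?; exact: cvg_id.
  exact: norm_continuous.
by apply: continuous_ln; rewrite ltr_pwDl.
Qed.

(** For large [t] one has [1 <= r + |w - t| <= (1 + |t|)^2]: the first bound makes
the logarithm nonnegative, the second gives the growth constant [2]. *)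
Lemma log_growth_reg_log r w : (0 < r)%R -> log_growth (reg_log r w).
Proof.
move=> r0; exists 2%R => //; exists (`|w| + r + 1)%R => t wt.
have t0 : (0 <= `|t|)%R by [].
have w0 : (0 <= `|w|)%R by [].
have le1 : (1 <= r + `|w - t|)%R.
  by have := lerB_dist t w; rewrite distrC; lra.
rewrite /reg_log ger0_norm ?ln_ge0// mulr_natl -lnXn ?ltr_pwDl//.
rewrite ler_ln ?posrE ?ltr_pwDl ?exprn_gt0 ?ltr_pwDl//.
by have := ler_normB w t; nra.
Qed.

Lemma lne_le_reg_log r v w t : (0 < r)%R -> (`|v - w| <= r)%R ->
  lne (`|v - t|%R)%:E <= (reg_log r w t)%:E.
Proof.
move=> r0 vw; rewrite /lne; case: ifPn => [_|]; first exact: leNye.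
rewrite -ltNge => vt; rewrite lee_fin ler_ln ?posrE ?ltr_pwDl//.
by rewrite (le_trans (ler_distD w _ _))// lerD2r.
Qed.

(** When [t = w] both sides tend to [-oo], in agreement with [lne 0 = -oo];
elsewhere this is continuity of the logarithm. *)
Lemma reg_log_cvg w t :
  (reg_log k.+1%:R^-1 w t)%:E @[k --> \oo] --> lne (`|w - t|%R)%:E.
Proof.
have h0 := @cvg_harmonic R.
rewrite /lne; case: ifPn => [|].
  rewrite normr_le0 => /eqP wt; apply/cvgeNyPle => A.
  have /cvgr0_norm_le/(_ _ (expR_gt0 A)) := h0.
  apply: filterS => k; rewrite lee_fin /reg_log wt normr0 addr0.
  rewrite ger0_norm ?invr_ge0// => kA.
  by rewrite -(expRK A) ler_ln ?posrE ?expR_gt0// invr_gt0.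
rewrite -ltNge => wt; apply: cvg_EFin; first exact: nearW.
apply: (@cvg_comp _ _ _ (fun k => k.+1%:R^-1 + `|w - t|)%R (@ln R)); last first.
  exact: continuous_ln.
have := cvgD h0 (@cvg_cst R `|w - t|%R _ \oo _); rewrite add0r; exact.
Qed.

Lemma measurable_lne_dist w :
  measurable_fun setT (fun t => lne (`|w - t|%R)%:E).
Proof.
apply: (@emeasurable_fun_cvg _ _ _ _ (fun k t => (reg_log k.+1%:R^-1 w t)%:E)).
  move=> k; apply/measurable_EFinP; apply: continuous_measurable_Rcomplex.
  exact: continuous_reg_log.
by move=> t _; exact: reg_log_cvg.
Qed.

End log_kernel.

(** * The principle of descent *)

Section descent.
Variables (R : realType)
  (mus : nat -> {finite_measure set (Rcomplex R) -> \bar R})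
  (mu : {finite_measure set (Rcomplex R) -> \bar R}).
Hypotheses (mu_tight : log_tight mus) (mu_cvg : weak_star_cvg mus mu).
Variables (z_ : nat -> Rcomplex R) (w : Rcomplex R).
Hypothesis z_w : z_ @ \oo --> w.

(** Some regularisation has [mu]-integral below [a] already, as otherwise the
limit kernel would have integral at least [a]. Its [mus n]-integrals are then
eventually below [a] too, and they dominate those of the kernel with pole
[z_ n]. *)
Lemma near_integral_lne_le (a : R) :
  \int[mu]_t lne (`|w - t|%R)%:E < a%:E ->
  \forall n \near \oo, \int[mus n]_t lne (`|z_ n - t|%R)%:E <= a%:E.
Proof.
move=> Ia.
have r0 k : (0 < k.+1%:R^-1 :> R)%R by rewrite invr_gt0.
have creg k := continuous_reg_log (w := w) (r0 k).
have greg k := log_growth_reg_log w (r0 k).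
have ireg k := weak_star_integrable mu_tight mu_cvg (creg k) (greg k).
have [k ka] : exists k, \int[mu]_t (reg_log k.+1%:R^-1 w t)%:E < a%:E.
  apply: contrapT => /forallNP nka; move: Ia; rewrite ltNge => /negP; apply.
  apply: (integral_lbound_decreasing ireg).
  - move=> t k l kl; rewrite ler_ln ?posrE ?ltr_pwDl//.
    by rewrite lerD2r lef_pV2 ?posrE// ler_nat.
  - exact: reg_log_cvg.
  - by move=> k; rewrite leNgt; apply/negP; exact: nka.
have rlt : (\int[mu]_t reg_log k.+1%:R^-1 w t < a)%R.
  rewrite -lte_fin /Rintegral fineK//.
  exact: (integrable_fin_num measurableT (ireg k)).
have /cvgr_lt/(_ _ rlt) := weak_star_log_growth mu_tight mu_cvg (creg k) (greg k).
have /cvgr_distC_le/(_ _ (r0 k)) := z_w.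
apply: filterS2 => n zn na.
apply: (@le_trans _ _ (\int[mus n]_t (reg_log k.+1%:R^-1 w t)%:E)).
  apply: le_integral_measurable.
  - exact: measurable_lne_dist.
  - by apply/measurable_EFinP; exact: continuous_measurable_Rcomplex.
  - by move=> t; exact: lne_le_reg_log.
have /integrable_fin_num : (mus n).-integrable setT
    (EFin \o reg_log k.+1%:R^-1 w) by exact: log_tight_integrable.
by move=> /(_ measurableT)/fineK <-; rewrite lee_fin; exact: ltW.
Qed.

Lemma logpotential_le_limn_einf :
  logpotential mu w <= limn_einf (fun n => logpotential (mus n) (z_ n)).
Proof.
have key (a : R) : \int[mu]_t lne (`|w - t|%R)%:E < a%:E ->
    (- a)%:E <= limn_einf (fun n => logpotential (mus n) (z_ n)).
  move=> /near_integral_lne_le na; apply: limn_einf_ge.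
  by apply: filterS na => n na; rewrite EFinN leeN2.
move: key; rewrite [logpotential mu w]/logpotential.
case: (\int[mu]_t lne _) => [r| |] key.
- apply/lee_subgt0Pr => e e0; rewrite [leLHS](_ : _ = (- (r + e))%:E).
    by apply: key; rewrite lte_fin ltrDl.
  by rewrite opprD EFinD.
- exact: leNye.
- rewrite leye_eq; apply/eqP/eqyP => A _; rewrite -(opprK A).
  by apply: key; exact: ltNyr.
Qed.

End descent.

Theorem theorem4p7 (R : realType)
    (mus : nat -> {finite_measure set (Rcomplex R) -> \bar R})
    (mu : {finite_measure set (Rcomplex R) -> \bar R})
    (mu_tight : log_tight mus) (mu_cvg : weak_star_cvg mus mu) :
  (forall z : Rcomplex R,
     logpotential mu z <= limn_einf (fun n => logpotential (mus n) z)) /\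
  (forall (z_ : nat -> Rcomplex R) (zstar : Rcomplex R),
     z_ @ \oo --> zstar ->
     logpotential mu zstar <= limn_einf (fun n => logpotential (mus n) (z_ n))).
Proof.
split=> [z|z_ w z_w]; last exact: logpotential_le_limn_einf.
apply: (logpotential_le_limn_einf mu_tight mu_cvg (z_ := fun=> z)).
exact: cvg_cst.
Qed.
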